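(* Let $f$ be a smooth symmetric function on $\Gamma$ (with $\Gamma\subset\mathbb R^n$ as in the context) such that $f_i=\partial f/\partial\lambda_i>0$ in $\Gamma$ for all $1\le i\le n$ and $f$ is concave in $\Gamma$. Then the following statements are equivalent: (1) $\lim_{t\to+\infty}f(t\lambda)>-\infty$ for every $\lambda\in\Gamma$; (2) $\lim_{t\to+\infty}f(t\lambda)>f(\mu)$ for all $\lambda,\mu\in\Gamma$; (3) $\limsup_{t\to+\infty}f(t\lambda)/t\ge0$ for every $\lambda\in\Gamma$; (4) $\sum_{i=1}^nf_i(\lambda)\mu_i\ge0$ for all $\lambda,\mu\in\Gamma$; (5) $f(\lambda+\mu)\ge f(\lambda)$ for all $\lambda,\mu\in\Gamma$; (6) $\sum_{i=1}^nf_i(\lambda)\lambda_i\ge0$ for all $\lambda\in\Gamma$; (7) $\sum_{i=1}^nf_i(\lambda)\mu_i>0$ for all $\lambda,\mu\in\Gamma$; (8) $f(\lambda+\mu)>f(\lambda)$ for all $\lambda,\mu\in\Gamma$.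
   Context: $\Gamma\subset\mathbb R^n$ is an open symmetric (under permutations of coordinates) convex cone with vertex at the origin, containing the positive cone $\Gamma_n=\{\lambda\in\mathbb R^n:\text{each }\lambda_i>0\}$, with $\partial\Gamma\ne\emptyset$. Limits as $t\to+\infty$ are taken in the extended reals (they exist by concavity). *)

(* Defs.v *)
From mathcomp Require Export all_boot all_order all_fingroup all_algebra.
From mathcomp Require Export all_classical all_reals all_analysis.

Set Implicit Arguments.
Unset Strict Implicit.
Unset Printing Implicit Defensive.

Export Order.TTheory GRing.Theory Num.Theory.
Export numFieldNormedType.Exports.

#[global] Open Scope classical_set_scope.
#[global] Open Scope ring_scope.

(* R^n is 'rV[R]_n; the library's sup norm on it induces the Euclidean
   topology. *)

Definition boundary (T : topologicalType) (A : set T) : set T :=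
  closure A `\` interior A.

Definition cone (R : realType) (n : nat) (G : set 'rV[R]_n) : Prop :=
  forall (t : R) (x : 'rV[R]_n), 0 < t -> G x -> G (t *: x).

Definition symmetric_set (R : realType) (n : nat) (G : set 'rV[R]_n) : Prop :=
  forall (s : 'S_n) (x : 'rV[R]_n), G x -> G (col_perm s x).

Definition symmetric_on (R : realType) (n : nat) (G : set 'rV[R]_n)
    (f : 'rV[R]_n -> R) : Prop :=
  forall (s : 'S_n) (x : 'rV[R]_n), G x -> f (col_perm s x) = f x.

Definition positive_cone (R : realType) (n : nat) : set 'rV[R]_n :=
  [set x | forall i, 0 < x ord0 i].

Definition partial (R : realType) (n : nat) (i : 'I_n) (f : 'rV[R]_n -> R) :
    'rV[R]_n -> R :=
  fun x => 'D_(delta_mx ord0 i) f x.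

(* Infinite differentiability: every iterated partial derivative is (Frechet)
   differentiable at every point of G, hence also continuous there. Meant for
   G open, so that only the values of f on G matter. *)
Definition smooth_on (R : realType) (n : nat) (G : set 'rV[R]_n)
    (f : 'rV[R]_n -> R) : Prop :=
  forall (s : seq 'I_n) (x : 'rV[R]_n), G x ->
    differentiable (foldr (@partial R n) f s) x.

(* Concavity of f on G; the library only has convex functions. *)
Definition concave_on (R : realType) (n : nat) (G : set 'rV[R]_n)
    (f : 'rV[R]_n -> R) : Prop :=
  convex_function G (fun x => - f x).

Definition ray_lim (R : realType) (n : nat) (f : 'rV[R]_n -> R)
    (x : 'rV[R]_n) : \bar R :=
  lim ((f (t *: x))%:E @[t --> +oo%R]).

Definition ray_slope_limsup (R : realType) (n : nat) (f : 'rV[R]_n -> R)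
    (x : 'rV[R]_n) : \bar R :=
  limf_esup (fun t : R => (f (t *: x) / t)%:E) (pinfty_nbhs R).

(* Main.v *)
(** By concavity the graph of f lies below its tangent hyperplanes,
    f(y) <= f(x) + df(x)(y - x) on G. If df(x)x < 0, then following the ray
    through x this bound tends to -oo, so (1) gives (6). Conversely (6) makes f
    nondecreasing along rays; then t df(x)y >= f(ty) - f(x) + df(x)x is bounded
    below as t -> +oo, which forces df(x)y >= 0, and the same bound divided by t
    handles (3). As G is open, y - e(1,...,1) is still in G for small e > 0, so
    df(x)y >= e sum_i f_i(x) > 0. The tangent inequality at x + y turns signs of
    df(x + y)y into monotonicity of f. Finally x - e y is in G for small e > 0,
    so f(y) < f(y + (x/e - y)) = f(x/e), and (2) follows from monotonicity along
    rays. *)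

Require Import Defs.
From mathcomp Require Import lra.

Set Implicit Arguments.
Unset Strict Implicit.
Unset Printing Implicit Defensive.

Definition grad_dot (R : realType) (n : nat) (f : 'rV[R]_n -> R)
    (x v : 'rV[R]_n) : R :=
  \sum_(i < n) partial i f x * v ord0 i.

Lemma grad_dotD (R : realType) (n : nat) (f : 'rV[R]_n -> R)
    (x v w : 'rV[R]_n) :
  grad_dot f x (v + w) = grad_dot f x v + grad_dot f x w.
Proof.
by rewrite -big_split; apply: eq_bigr => i _; rewrite mxE mulrDr.
Qed.

Lemma grad_dotZ (R : realType) (n : nat) (f : 'rV[R]_n -> R) (a : R)
    (x v : 'rV[R]_n) :
  grad_dot f x (a *: v) = a * grad_dot f x v.
Proof.
by rewrite /grad_dot big_distrr; apply: eq_bigr => i _; rewrite mxE mulrCA.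
Qed.

Lemma grad_dotB (R : realType) (n : nat) (f : 'rV[R]_n -> R)
    (x v w : 'rV[R]_n) :
  grad_dot f x (v - w) = grad_dot f x v - grad_dot f x w.
Proof. by rewrite -scaleN1r grad_dotD grad_dotZ mulN1r. Qed.

Lemma derive_grad_dot (R : realType) (n : nat) (f : 'rV[R]_n -> R)
    (x v : 'rV[R]_n) :
  differentiable f x -> 'D_v f x = grad_dot f x v.
Proof.
move=> df; rewrite deriveE// [v in LHS]row_sum_delta linear_sum.
by apply: eq_bigr => i _; rewrite /partial deriveE// linearZ mulrC.
Qed.

(** Concavity bounds the difference quotient (f(x + h(y - x)) - f(x))/h below by f(y) - f(x) for 0 <
    h <= 1. Letting h tend to 0 from the right turns the quotient into the directional
    derivative. *)
Lemma concave_on_le_tangent (R : realType) (n : nat) (G : set 'rV[R]_n)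
    (f : 'rV[R]_n -> R) (x y : 'rV[R]_n) :
  concave_on G f -> differentiable f x -> G x -> G y ->
  f y <= f x + grad_dot f x (y - x).
Proof.
move=> cf df Gx Gy; rewrite -lerBlDl -derive_grad_dot//.
have /cvg_dnbhs_at_right quot : derivable f x (y - x) by exact: diff_derivable.
apply: (cvgr_to_ge quot); near=> h => /=.
have h0 : 0 < h by near: h; exact: nbhs_right_gt.
have h1 : h <= 1 by near: h; exact: nbhs_right_le.
have := cf (Itv01 (ltW h0) h1) y x (mem_set Gy) (mem_set Gx).
rewrite convRE /conv/= /unstable.onem.
have -> : h *: (y - x) + x = h *: y + (1 - h) *: x.
  by rewrite scalerBr scalerBl scale1r -addrA [- _ + x]addrC.
move=> hf; rewrite -[leLHS](mulKf (lt0r_neq0 h0)) ler_pM2l ?invr_gt0//.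
lra.
Unshelve. all: by end_near. Qed.

(** The sum is twice the midpoint of [x] and [y]. *)
Lemma convex_coneD (R : realType) (n : nat) (G : set 'rV[R]_n)
    (x y : 'rV[R]_n) :
  convex_set G -> cone G -> G x -> G y -> G (x + y).
Proof.
move=> cG kG Gx Gy.
have h0 : 0 <= 2^-1 :> R by lra.
have h1 : 2^-1 <= 1 :> R by lra.
have := cG x y (Itv01 h0 h1) (mem_set Gx) (mem_set Gy).
move=> /set_mem /(kG 2 _ (ltr0Sn _ _)); rewrite /conv/= /unstable.onem.
rewrite scalerDr !scalerA divff ?pnatr_eq0// scale1r.
by rewrite (_ : 2 * (1 - 2^-1) = 1) ?scale1r//; lra.
Qed.

Lemma open_subZ (R : realType) (n : nat) (G : set 'rV[R]_n)
    (x v : 'rV[R]_n) :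
  open G -> G x -> exists2 e, 0 < e & G (x - e *: v).
Proof.
move=> oG Gx.
have Gcvg : (x - e *: v) @[e --> (0 : R)^'+] --> x.
  rewrite -[X in _ --> X]subr0 -(scale0r v); apply: cvg_at_right_filter.
  by apply: cvgB; [exact: cvg_cst|apply: cvgZr_tmp; exact: cvg_id].
have Gnear : nbhs x G by exact: open_nbhs_nbhs.
near (0 : R)^'+ => e; exists e; near: e; first exact: nbhs_right_gt.
exact: Gcvg Gnear.
Unshelve. all: by end_near. Qed.

Lemma lime_pinfty_ge_nondecreasing (R : realType) (g : R -> R) (a t : R) :
  (forall r s, a <= r -> r <= s -> g r <= g s) -> a <= t ->
  ((g t)%:E <= lim ((g s)%:E @[s --> +oo%R]))%E.
Proof.
move=> gnd at_; apply: lime_ge; last first.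
  exists t; split; first exact: num_real.
  by move=> s /ltW ts; rewrite lee_fin; exact: gnd.
(* Convergence remains to be shown. As [g] is monotone only from [a] on, it is replaced by g(max(a,
   s)), which is monotone on the whole line and agrees with [g] for s >= a. *)
have h_nd : {homo (fun s => (g (Num.max a s))%:E) :
    r s / r <= s >-> (r <= s)%E}.
  move=> r s rs; rewrite lee_fin; apply: gnd; first by rewrite le_max lexx.
  by rewrite ge_max !le_max lexx rs orbT.
have /cvg_ex[l hl] := nondecreasing_is_cvge h_nd.
apply/cvg_ex; exists l; apply: cvg_trans hl; apply: near_eq_cvg.
near=> s; rewrite max_r//; near: s; exact: nbhs_pinfty_ge (num_real _).
Unshelve. all: by end_near. Qed.

Theorem lemma3p2 (R : realType) (n : nat) (G : set 'rV[R]_n)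
    (f : 'rV[R]_n -> R)
    (G_open : open G)
    (G_symmetric : symmetric_set G)
    (G_convex : convex_set G)
    (G_cone : cone G)
    (G_positive : @positive_cone R n `<=` G)
    (G_boundary : boundary G !=set0)
    (f_smooth : smooth_on G f)
    (f_symmetric : symmetric_on G f)
    (f_partial_gt0 : forall (i : 'I_n) (x : 'rV[R]_n), G x ->
       0 < partial i f x)
    (f_concave : concave_on G f) :
  [<-> (* 1 *) forall x : 'rV[R]_n, G x -> (-oo < ray_lim f x)%E;
       (* 2 *) forall x y : 'rV[R]_n, G x -> G y ->
                 ((f y)%:E < ray_lim f x)%E;
       (* 3 *) forall x : 'rV[R]_n, G x -> (0 <= ray_slope_limsup f x)%E;
       (* 4 *) forall x y : 'rV[R]_n, G x -> G y ->
                 0 <= \sum_(i < n) partial i f x * y ord0 i;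
       (* 5 *) forall x y : 'rV[R]_n, G x -> G y -> f x <= f (x + y);
       (* 6 *) forall x : 'rV[R]_n, G x ->
                 0 <= \sum_(i < n) partial i f x * x ord0 i;
       (* 7 *) forall x y : 'rV[R]_n, G x -> G y ->
                 0 < \sum_(i < n) partial i f x * y ord0 i;
       (* 8 *) forall x y : 'rV[R]_n, G x -> G y -> f x < f (x + y)].
Proof.
have tangent x y : G x -> G y -> f y <= f x + grad_dot f x (y - x).
  by move=> Gx; exact: concave_on_le_tangent f_concave (f_smooth [::] x Gx) Gx.
(* For n = 0 the positive cone is the whole space, so [G] would have empty boundary. A coordinate
   must exist for the sum of the partial derivatives to be strictly positive. *)
have n_gt0 : (0 < n)%N.
  case: (posnP n) => // n0; have [x [_]] := G_boundary.
  rewrite ((interior_id G).1 G_open); case; apply: G_positive => i.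
  by have := ltn_ord i; rewrite [X in (_ < X)%N]n0.
have euler_of_ray_lim : (forall x, G x -> (-oo < ray_lim f x)%E) ->
    forall x, G x -> 0 <= grad_dot f x x.
  move=> limNy x Gx; rewrite leNgt; apply/negP => d_lt0.
  have : (f (t *: x))%:E @[t --> +oo] --> -oo%E.
    apply/cvgeNyPle => A; near=> t.
    have t0 : 0 < t by near: t; exact: nbhs_pinfty_gt (num_real _).
    rewrite lee_fin; apply: (le_trans (tangent _ _ Gx (G_cone _ _ t0 Gx))).
    rewrite grad_dotB grad_dotZ.
    (* This threshold solves f(x) + (t - 1) df(x)x <= A for t; dividing by the negative df(x)x
       reverses the inequality. *)
    have : (A - f x + grad_dot f x x) / grad_dot f x x <= t.
      by near: t; exact: nbhs_pinfty_ge (num_real _).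
    by rewrite ler_ndivrMr//; lra.
  by move/cvg_lim => limE; have := limNy _ Gx; rewrite /ray_lim limE.
have ray_nondecr : (forall x, G x -> 0 <= grad_dot f x x) ->
    forall x, G x -> forall s t : R, 0 < s -> s <= t ->
    f (s *: x) <= f (t *: x).
  move=> euler x Gx s t s0 st; have t0 := lt_le_trans s0 st.
  have := tangent (t *: x) (s *: x) (G_cone _ _ t0 Gx) (G_cone _ _ s0 Gx).
  have := euler _ (G_cone _ _ t0 Gx).
  rewrite grad_dotB !grad_dotZ pmulr_rge0// => d0.
  by have := ler_wpM2r d0 st; lra.
have grad_ge0_of_euler : (forall x, G x -> 0 <= grad_dot f x x) ->
    forall x y, G x -> G y -> 0 <= grad_dot f x y.
  move=> euler x y Gx Gy; rewrite leNgt; apply/negP => d_lt0.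
  (* Monotonicity along the ray and the tangent at [x] give C <= t df(x)y for all t >= 1, whereas
     the [t] chosen next makes t df(x)y <= C - 1. *)
  set C := f y - f x + grad_dot f x x.
  set t := Num.max 1 ((C - 1) / grad_dot f x y).
  have t1 : 1 <= t by rewrite le_max lexx.
  have t0 : 0 < t by lra.
  have : (C - 1) / grad_dot f x y <= t by rewrite le_max lexx orbT.
  rewrite ler_ndivrMr//.
  have := tangent x (t *: y) Gx (G_cone _ _ t0 Gy).
  have := ray_nondecr euler y Gy 1 t ltr01 t1.
  rewrite scale1r grad_dotB grad_dotZ /C; lra.
have grad_gt0_of_ge0 : (forall x y, G x -> G y -> 0 <= grad_dot f x y) ->
    forall x y, G x -> G y -> 0 < grad_dot f x y.
  move=> grad_ge0 x y Gx Gy.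
  have [e e0 Ge] := open_subZ (const_mx 1) G_open Gy.
  have := grad_ge0 _ _ Gx Ge; rewrite grad_dotB grad_dotZ subr_ge0.
  apply: lt_le_trans; rewrite mulr_gt0// /grad_dot.
  under eq_bigr do rewrite mxE mulr1.
  rewrite (bigD1 (Ordinal n_gt0))//= ltr_wpDr ?f_partial_gt0//.
  by apply: sumr_ge0 => i _; exact/ltW/f_partial_gt0.
have incr_of_grad_gt0 : (forall x y, G x -> G y -> 0 < grad_dot f x y) ->
    forall x y, G x -> G y -> f x < f (x + y).
  move=> grad_gt0 x y Gx Gy; have Gxy := convex_coneD G_convex G_cone Gx Gy.
  have := tangent _ _ Gxy Gx; have := grad_gt0 _ _ Gxy Gy.
  by rewrite grad_dotB grad_dotD; lra.
tfae.
- move=> limNy x y Gx Gy; have euler := euler_of_ray_lim limNy.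
  have incr := incr_of_grad_gt0 (grad_gt0_of_ge0 (grad_ge0_of_euler euler)).
  have [e e0 Ge] := open_subZ y G_open Gx.
  have ei0 : 0 < e^-1 by rewrite invr_gt0.
  have := incr _ _ Gy (G_cone _ _ ei0 Ge).
  rewrite scalerBr scalerA mulVf ?gt_eqF// scale1r addrC subrK -lte_fin.
  move=> /lt_le_trans; apply; rewrite /ray_lim.
  apply: (@lime_pinfty_ge_nondecreasing _ (fun t => f (t *: x)) e^-1) => //.
  move=> r s er.
  by apply: ray_nondecr => //; exact: lt_le_trans er.
- move=> lim_gt x Gx.
  (* Statement (2) with both points equal yields (1), hence (6). *)
  have euler := euler_of_ray_lim
    (fun z Gz => lt_trans (ltNyr (f z)) (lim_gt z z Gz Gz)).
  apply: le_ereal_inf_tmp => _ [A [M [_ MA]] <-].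
  (* It suffices to find t > M with f(tx)/t >= -e. For t >= 1 one has f(tx) >= f(x), so any such t
     with t >= -f(x)/e works. *)
  apply/lee_addgt0Pr => e e0.
  near (pinfty_nbhs R) => t.
  have t1 : 1 <= t by near: t; exact: nbhs_pinfty_ge (num_real _).
  have t0 : 0 < t by lra.
  apply: (@le_trans _ _ ((f (t *: x) / t)%:E + e%:E)%E); last first.
    rewrite leeD2r//; apply: ereal_sup_ubound; exists t => //.
    by apply: MA; near: t; exact: nbhs_pinfty_gt (num_real _).
  rewrite -EFinD lee_fin -(pmulr_lge0 _ t0) mulrDl divfK ?gt_eqF//.
  have := ray_nondecr euler x Gx 1 t ltr01 t1; rewrite scale1r.
  have : - f x / e <= t by near: t; exact: nbhs_pinfty_ge (num_real _).
  by rewrite ler_pdivrMr//; lra.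
- move=> slope_ge0 x y Gx Gy; rewrite -/(grad_dot f x y) leNgt.
  apply/negP => d_lt0; have := slope_ge0 _ Gy; rewrite leNgt => /negP; apply.
  set d := grad_dot f x y in d_lt0 *.
  set C := f x - grad_dot f x x.
  (* For t > M the tangent bound f(ty) <= C + td is below td/2, so the supremum of f(ty)/t over t >
     M is at most d/2 < 0. *)
  set M := Num.max 1 (C / (- d / 2)).
  apply: (@le_lt_trans _ _ (d / 2)%:E); last by rewrite lte_fin; lra.
  apply: (@le_trans _ _
    (ereal_sup ((fun t => (f (t *: y) / t)%:E) @` [set t | M < t]))).
    apply: ereal_inf_lbound; exists [set t | M < t] => //.
    by exists M; split=> //; exact: num_real.
  apply: ge_ereal_sup => _ [t /= Mt <-]; move: Mt; rewrite gt_max => /andP[t1].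
  have t0 : 0 < t by lra.
  rewrite ltr_pdivrMr; last by lra.
  rewrite lee_fin ler_pdivrMr//.
  have := tangent x (t *: y) Gx (G_cone _ _ t0 Gy).
  by rewrite grad_dotB grad_dotZ /C -/d; lra.
- move=> grad_ge0 x y Gx Gy; have Gxy := convex_coneD G_convex G_cone Gx Gy.
  have := tangent _ _ Gxy Gx; have := grad_ge0 _ _ Gxy Gy.
  by rewrite -/(grad_dot _ _ _) grad_dotB grad_dotD; lra.
(* The tangent at [x], evaluated at 2x, gives f(2x) - f(x) <= df(x)x. *)
- move=> mono x Gx; have Gxx := convex_coneD G_convex G_cone Gx Gx.
  have := tangent _ _ Gx Gxx; have := mono _ _ Gx Gx.
  by rewrite -/(grad_dot _ _ _) addrK; lra.
- by move=> euler; exact/grad_gt0_of_ge0/grad_ge0_of_euler.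
- exact: incr_of_grad_gt0.
(* As in the step from (5) to (6), df(z)z >= 0; then [f] is nondecreasing along rays and f(x) is a
   finite lower bound for the limit. *)
- move=> incr x Gx.
  have euler z : G z -> 0 <= grad_dot f z z.
    move=> Gz; have Gzz := convex_coneD G_convex G_cone Gz Gz.
    by have := tangent _ _ Gz Gzz; have := incr _ _ Gz Gz; rewrite addrK; lra.
  apply: (@lt_le_trans _ _ (f (1 *: x))%:E); first exact: ltNyr.
  apply: (@lime_pinfty_ge_nondecreasing _ (fun t => f (t *: x)) 1) => // r s r1.
  by apply: ray_nondecr => //; exact: lt_le_trans r1.
Unshelve. all: by end_near. Qed.
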